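(* Let $H$, $G$ be two groups and let $\beta:G\times H\to G$, $\beta(g,h)=g\lhd h$, be a right action of $H$ on $G$ by group automorphisms. Let $\alpha':G\times H\to H$, $\alpha'(g,h)=g\rhd'h$, and $\beta':G\times H\to G$, $\beta'(g,h)=g\lhd'h$, be two maps. The following statements are equivalent: (1) $(H,G,\alpha',\beta')$ is a matched pair of groups and there exists an isomorphism of groups $H\,{}_{\alpha'}\!\bowtie_{\beta'}G\cong H\rtimes_{\beta}G$ that fixes $H$. (2) There exists a pair $(r,v)$, where $r:G\to H$ is a morphism of groups and $v:G\to G$ is a bijective map such that $$v(g_1g_2)=\bigl(v(g_1)\lhd r(g_2)\bigr)v(g_2)$$ for all $g_1,g_2\in G$, and $\alpha'$, $\beta'$ are given by $$g\rhd'h=r(g)\,h\,\Bigl(r\circ v^{-1}\bigl(v(g)\lhd h\bigr)\Bigr)^{-1},\qquad g\lhd'h=v^{-1}\bigl(v(g)\lhd h\bigr)$$ for all $g\in G$, $h\in H$. The isomorphism $\psi:H\,{}_{\alpha'}\!\bowtie_{\beta'}G\to H\rtimes_{\beta}G$ fixing $H$ is given by $\psi(h,g)=(h\,r(g),v(g))$ for all $h\in H$, $g\in G$.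
   Context: A matched pair of groups $(H,G,\alpha',\beta')$ consists of groups $H$, $G$, a left action $\alpha'(g,h)=g\rhd'h$ of the group $G$ on the set $H$, and a right action $\beta'(g,h)=g\lhd'h$ of the group $H$ on the set $G$, such that for all $g,g_1,g_2\in G$, $h,h_1,h_2\in H$: $g\rhd'(h_1h_2)=(g\rhd'h_1)\bigl((g\lhd'h_1)\rhd'h_2\bigr)$ and $(g_1g_2)\lhd'h=\bigl(g_1\lhd'(g_2\rhd'h)\bigr)(g_2\lhd'h)$. The bicrossed product $H\,{}_{\alpha'}\!\bowtie_{\beta'}G$ is the group on the set $H\times G$ with unit $(1_H,1_G)$ and multiplication $(h_1,g_1)(h_2,g_2)=\bigl(h_1(g_1\rhd'h_2),\,(g_1\lhd'h_2)g_2\bigr)$. A right action $\beta$ of $H$ on $G$ by group automorphisms is a right action of the group $H$ on the set $G$ with $(g_1g_2)\lhd h=(g_1\lhd h)(g_2\lhd h)$. $H\rtimes_{\beta}G$ is the right version of the semidirect product: the set $H\times G$ with multiplication $(h_1,g_1)(h_2,g_2)=(h_1h_2,\,(g_1\lhd h_2)g_2)$. A morphism $\psi$ between two such groups fixes $H$ if $\psi(h,1)=(h,1)$ for all $h\in H$. *)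

(* Defs.v *)
From HB Require Import structures.
From mathcomp Require Import all_boot.
Set Implicit Arguments. Unset Strict Implicit. Unset Printing Implicit Defensive.
Local Open Scope group_scope.

Section Actions.
Variables (A : groupType) (X : Type).

Record left_action (f : A -> X -> X) : Prop := LeftAction {
  lact1 : forall x, f 1 x = x;
  lactM : forall a b x, f (a * b) x = f a (f b x) }.

Record right_action (f : X -> A -> X) : Prop := RightAction {
  ract1 : forall x, f x 1 = x;
  ractM : forall x a b, f x (a * b) = f (f x a) b }.

End Actions.

Record matched_pair (H G : groupType) (alpha : G -> H -> H) (beta : G -> H -> G)
    : Prop := MatchedPair {
  mp_lact : left_action alpha;
  mp_ract : right_action beta;
  mp_alphaM : forall g h1 h2,
    alpha g (h1 * h2) = alpha g h1 * alpha (beta g h1) h2;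
  mp_betaM : forall g1 g2 h,
    beta (g1 * g2) h = beta g1 (alpha g2 h) * beta g2 h }.

Record right_action_by_automorphisms (H G : groupType) (beta : G -> H -> G)
    : Prop := RightActionByAutomorphisms {
  raut_ract : right_action beta;
  raut_betaM : forall g1 g2 h, beta (g1 * g2) h = beta g1 h * beta g2 h }.

(* The two types below are transparent aliases of [H * G], so that pairs inhabit
   them directly; the alias selects the group law, which is not the componentwise
   one that MathComp puts on [H * G]. Explicit pairs must be ascribed to the alias
   before they are multiplied. *)

Definition bicrossed (H G : groupType) (alpha : G -> H -> H) (beta : G -> H -> G)
  (mp : matched_pair alpha beta) : Type := (H * G)%type.

Section Bicrossed.
Variables (H G : groupType) (alpha : G -> H -> H) (beta : G -> H -> G).
Variable mp : matched_pair alpha beta.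
Implicit Types x y z : bicrossed mp.

Definition bicrossed_one : bicrossed mp := (1, 1).
Definition bicrossed_mul x y : bicrossed mp :=
  (x.1 * alpha x.2 y.1, beta x.2 y.1 * y.2).
Definition bicrossed_inv x : bicrossed mp :=
  (alpha x.2^-1 x.1^-1, beta x.2^-1 x.1^-1).

Lemma mp_alpha1 g : alpha g 1 = 1.
Proof.
apply: (@mulgI _ (alpha g 1)); rewrite mulg1 -[in RHS](mulg1 1) (mp_alphaM mp).
by rewrite (ract1 (mp_ract mp)).
Qed.

Lemma mp_beta1 h : beta 1 h = 1.
Proof.
apply: (@mulgI _ (beta 1 h)); rewrite mulg1 -[in RHS](mulg1 1) (mp_betaM mp).
by rewrite (lact1 (mp_lact mp)).
Qed.

Lemma bicrossed_mulA : associative bicrossed_mul.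
Proof.
case: (mp) => -[a1 aM] [b1 bM] aD bD.
move=> [h1 g1] [h2 g2] [h3 g3]; congr (_, _) => /=.
  by rewrite aD aM mulgA.
by rewrite bD bM mulgA.
Qed.

Lemma bicrossed_mul1 : left_id bicrossed_one bicrossed_mul.
Proof.
move=> [h g]; congr (_, _) => /=; first by rewrite (lact1 (mp_lact mp)) mul1g.
by rewrite mp_beta1 mul1g.
Qed.

Lemma bicrossed_mulr1 : right_id bicrossed_one bicrossed_mul.
Proof.
move=> [h g]; congr (_, _) => /=; first by rewrite mp_alpha1 mulg1.
by rewrite (ract1 (mp_ract mp)) mulg1.
Qed.

Lemma bicrossed_mulV : left_inverse bicrossed_one bicrossed_inv bicrossed_mul.
Proof.
move=> [h g]; congr (_, _) => /=.
  by rewrite -(mp_alphaM mp) mulVg mp_alpha1.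
rewrite -(ractM (mp_ract mp)) mulVg (ract1 (mp_ract mp)).
by rewrite mulVg.
Qed.

Lemma bicrossed_mulrV : right_inverse bicrossed_one bicrossed_inv bicrossed_mul.
Proof.
move=> [h g]; congr (_, _) => /=.
  by rewrite -(lactM (mp_lact mp)) mulgV (lact1 (mp_lact mp)) mulgV.
by rewrite -(mp_betaM mp) mulgV mp_beta1.
Qed.

HB.instance Definition _ := Choice.copy (bicrossed mp) (H * G)%type.
HB.instance Definition _ := isGroup.Build (bicrossed mp)
  bicrossed_mulA bicrossed_mul1 bicrossed_mulr1 bicrossed_mulV bicrossed_mulrV.

End Bicrossed.

Definition rsemidirect (H G : groupType) (beta : G -> H -> G)
  (ra : right_action_by_automorphisms beta) : Type := (H * G)%type.

Section RSemidirect.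
Variables (H G : groupType) (beta : G -> H -> G).
Variable ra : right_action_by_automorphisms beta.
Implicit Types x y z : rsemidirect ra.

Definition rsemidirect_one : rsemidirect ra := (1, 1).
Definition rsemidirect_mul x y : rsemidirect ra :=
  (x.1 * y.1, beta x.2 y.1 * y.2).
Definition rsemidirect_inv x : rsemidirect ra :=
  (x.1^-1, beta x.2^-1 x.1^-1).

Lemma raut_beta1 h : beta 1 h = 1.
Proof.
by apply: (@mulgI _ (beta 1 h)); rewrite mulg1 -(raut_betaM ra) mulg1.
Qed.

Lemma rsemidirect_mulA : associative rsemidirect_mul.
Proof.
case: (ra) => -[b1 bM] bD.
move=> [h1 g1] [h2 g2] [h3 g3]; congr (_, _) => /=; first by rewrite mulgA.
by rewrite bD bM mulgA.
Qed.

Lemma rsemidirect_mul1 : left_id rsemidirect_one rsemidirect_mul.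
Proof.
by move=> [h g]; congr (_, _) => /=; rewrite ?raut_beta1 mul1g.
Qed.

Lemma rsemidirect_mulr1 : right_id rsemidirect_one rsemidirect_mul.
Proof.
by move=> [h g]; congr (_, _) => /=; rewrite ?(ract1 (raut_ract ra)) mulg1.
Qed.

Lemma rsemidirect_mulV :
  left_inverse rsemidirect_one rsemidirect_inv rsemidirect_mul.
Proof.
move=> [h g]; congr (_, _) => /=; first by rewrite mulVg.
by rewrite -(ractM (raut_ract ra)) mulVg (ract1 (raut_ract ra)) mulVg.
Qed.

Lemma rsemidirect_mulrV :
  right_inverse rsemidirect_one rsemidirect_inv rsemidirect_mul.
Proof.
move=> [h g]; congr (_, _) => /=; first by rewrite mulgV.
by rewrite -(raut_betaM ra) mulgV raut_beta1.
Qed.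

HB.instance Definition _ := Choice.copy (rsemidirect ra) (H * G)%type.
HB.instance Definition _ := isGroup.Build (rsemidirect ra)
  rsemidirect_mulA rsemidirect_mul1 rsemidirect_mulr1
  rsemidirect_mulV rsemidirect_mulrV.

End RSemidirect.

Definition group_isomorphism (K L : groupType) (psi : K -> L) : Prop :=
  monoid_morphism psi /\ bijective psi.

Definition fixes_H (H G : groupType) (beta : G -> H -> G)
  (ra : right_action_by_automorphisms beta)
  (alpha' : G -> H -> H) (beta' : G -> H -> G) (mp : matched_pair alpha' beta')
  (psi : bicrossed mp -> rsemidirect ra) : Prop :=
  forall h : H, psi (h, 1) = (h, 1).

(* The conditions on the pair [(r, v)]; [w] is the inverse of [v], which is
   determined by [v]. *)
Definition deforming_pair (H G : groupType) (beta : G -> H -> G)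
    (alpha' : G -> H -> H) (beta' : G -> H -> G) (r : G -> H) (v : G -> G) : Prop :=
  monoid_morphism r /\
  exists w : G -> G,
    [/\ cancel v w /\ cancel w v,
        forall g1 g2, v (g1 * g2) = beta (v g1) (r g2) * v g2,
        forall g h, alpha' g h = r g * h * (r (w (beta (v g) h)))^-1
      & forall g h, beta' g h = w (beta (v g) h)].

(* Main.v *)
Require Import Defs.
From HB Require Import structures.
From mathcomp Require Import all_boot.
Local Open Scope group_scope.

(** A map [psi] that fixes [H] and is multiplicative on the bicrossed product is
    determined by the images [psi (1, g) = (r g, v g)], because
    [(h, g) = (h, 1) (1, g)]; hence [psi (h, g) = (h * r g, v g)]. For a map of
    this shape, multiplicativity amounts to its two special cases
    - [(1, g1) (1, g2) = (1, g1 * g2)], which says that [r] is a morphism and [v]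
      a cocycle, [v (g1 * g2) = beta (v g1) (r g2) * v g2];
    - [(1, g) (h, 1) = (alpha' g h, beta' g h)], which says that
      [alpha' g h * r (beta' g h) = r g * h] and
      [v (beta' g h) = beta (v g) h].
    Moreover [psi] is bijective exactly when [v] is. When [v] is invertible, the
    last two identities can be solved for [alpha'] and [beta'], and the solution is
    the pair of formulas in [deforming_pair]: this is [deforming_pairP], and the
    rest of the argument uses only the unsolved form.

    Conversely, given such [r] and [v], the map [(h, g) |-> (h * r g, v g)] is a
    bijection carrying the bicrossed multiplication to the group law of the
    semidirect product. The matched pair axioms follow by applying [v], or
    multiplying on the right by a value of [r], and reducing both sides with the
    identities above ([deforming_pair_matched]). *)

(** The inverse-free form of [deforming_pair]. *)
Lemma deforming_pairP (H G : groupType) (beta : G -> H -> G)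
    (alpha' : G -> H -> H) (beta' : G -> H -> G) (r : G -> H) (v : G -> G) :
  deforming_pair beta alpha' beta' r v <->
  [/\ monoid_morphism r, bijective v,
      forall g1 g2, v (g1 * g2) = beta (v g1) (r g2) * v g2,
      forall g h, alpha' g h * r (beta' g h) = r g * h
    & forall g h, v (beta' g h) = beta (v g) h].
Proof.
split=> [[rM [w [[vK wK] vM aE bE]]]|[rM [w vK wK] vM aE bE]].
  split=> // [|g h|g h]; first by exists w.
    by rewrite aE bE mulgVK.
  by rewrite bE wK.
split=> //; exists w; split=> // g h; last by rewrite -bE vK.
by rewrite -bE vK -aE mulgK.
Qed.

Lemma deforming_pair1 (H G : groupType) (beta : G -> H -> G)
    (alpha' : G -> H -> H) (beta' : G -> H -> G) (r : G -> H) (v : G -> G) :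
  right_action_by_automorphisms beta ->
  deforming_pair beta alpha' beta' r v -> v 1 = 1.
Proof.
case=> -[b1 _] _ /deforming_pairP[[r1 _] _ vM _ _].
by have := vM 1 1; rewrite r1 b1 mulg1 -[X in X = _]mulg1 => /mulgI.
Qed.

Lemma deforming_pair_matched (H G : groupType) (beta : G -> H -> G)
    (alpha' : G -> H -> H) (beta' : G -> H -> G) (r : G -> H) (v : G -> G) :
  right_action_by_automorphisms beta ->
  deforming_pair beta alpha' beta' r v -> matched_pair alpha' beta'.
Proof.
move=> ra rv; have /deforming_pairP[[r1 rM] v_bij vM aE bE] := rv.
have v_inj := bij_inj v_bij; case: (ra) => -[b1 bM] bD.
have v1 := deforming_pair1 _ _ _ _ _ _ _ ra rv.
have b'1 h : beta' 1 h = 1 by apply: v_inj; rewrite bE v1 (raut_beta1 ra).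
have b'D g1 g2 h : beta' (g1 * g2) h = beta' g1 (alpha' g2 h) * beta' g2 h.
  by apply: v_inj; rewrite vM !bE vM bD -!bM aE.
have b'M g h1 h2 : beta' g (h1 * h2) = beta' (beta' g h1) h2.
  by apply: v_inj; rewrite !bE bM.
split=> //.
- split=> [h|g1 g2 h].
    by apply: (mulIg (r (beta' 1 h))); rewrite aE b'1 r1 mul1g mulg1.
  apply: (mulIg (r (beta' (g1 * g2) h))).
  by rewrite aE b'D !rM mulgA aE -!mulgA aE.
- by split=> // g; apply: v_inj; rewrite bE b1.
- move=> g h1 h2; apply: (mulIg (r (beta' g (h1 * h2)))).
  by rewrite aE b'M -mulgA aE !mulgA aE.
Qed.

(** The matched pair [mp] is arbitrary here: its proof plays no role in the
    multiplication, so the statement applies to every bicrossed product built on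
    [alpha'] and [beta']. *)
Lemma deforming_pair_isomorphism (H G : groupType) (beta : G -> H -> G)
    (ra : right_action_by_automorphisms beta)
    (alpha' : G -> H -> H) (beta' : G -> H -> G) (mp : matched_pair alpha' beta')
    (r : G -> H) (v : G -> G) (psi : bicrossed mp -> rsemidirect ra) :
  deforming_pair beta alpha' beta' r v ->
  (forall h g, psi (h, g) = (h * r g, v g)) ->
  group_isomorphism psi /\ fixes_H psi.
Proof.
move=> rv psiE; have /deforming_pairP[[r1 rM] [w vK wK] vM aE bE] := rv.
case: (ra) => -[b1 bM] bD.
have v1 := deforming_pair1 _ _ _ _ _ _ _ ra rv.
have psi_fix : fixes_H psi by move=> h; rewrite psiE r1 mulg1 v1.
split=> //; split; first split; first exact: psi_fix.
  move=> [h1 g1] [h2 g2]; rewrite !psiE; congr (_, _) => /=.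
    by rewrite rM -!mulgA [alpha' _ _ * _]mulgA aE -!mulgA.
  by rewrite vM bE bM.
exists (fun x => (x.1 * (r (w x.2))^-1, w x.2)) => -[h g] /=.
  by rewrite psiE /= vK mulgK.
by rewrite psiE wK mulgVK.
Qed.

Lemma isomorphism_deforming_pair (H G : groupType) (beta : G -> H -> G)
    (ra : right_action_by_automorphisms beta)
    (alpha' : G -> H -> H) (beta' : G -> H -> G) (mp : matched_pair alpha' beta')
    (psi : bicrossed mp -> rsemidirect ra) :
  group_isomorphism psi -> fixes_H psi ->
  exists (r : G -> H) (v : G -> G),
    deforming_pair beta alpha' beta' r v
    /\ forall h g, psi (h, g) = (h * r g, v g).
Proof.
move=> [[psi1 psiM] [phi psiK phiK]] psi_fix.
pose r g := (psi (1, g)).1; pose v g := (psi (1, g)).2; exists r, v.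
have psi1E g : psi (1, g) = (r g, v g) by rewrite /r /v; case: (psi _).
have mulE h1 g1 h2 g2 :
    ((h1, g1) : bicrossed mp) * ((h2, g2) : bicrossed mp)
    = (h1 * alpha' g1 h2, beta' g1 h2 * g2) by [].
have smulE h1 g1 h2 g2 :
    ((h1, g1) : rsemidirect ra) * ((h2, g2) : rsemidirect ra)
    = (h1 * h2, beta g1 h2 * g2) by [].
have psiE h g : psi (h, g) = (h * r g, v g).
  have -> : (h, g) = ((h, 1) : bicrossed mp) * ((1, g) : bicrossed mp).
    by rewrite mulE (mp_alpha1 mp) (mp_beta1 mp) mulg1 mul1g.
  by rewrite psiM psi_fix psi1E smulE (raut_beta1 ra) mul1g.
split=> //; apply/deforming_pairP.
have psi_GG g1 g2 :
    (r (g1 * g2), v (g1 * g2)) = (r g1 * r g2, beta (v g1) (r g2) * v g2).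
  rewrite -psi1E -smulE -!psi1E -psiM mulE.
  by rewrite (mp_alpha1 mp) (ract1 (mp_ract mp)) mulg1.
have psi_GH g h :
    (alpha' g h * r (beta' g h), v (beta' g h)) = (r g * h, beta (v g) h).
  rewrite -psiE -[beta (v g) h]mulg1 -smulE -psi1E -psi_fix -psiM mulE.
  by rewrite mul1g mulg1.
(* Hence [v] inherits an inverse from [psi]: the second component of the
   preimage of [(1, g)]. *)
have vP g : psi ((r g)^-1, g) = (1, v g) by rewrite psiE mulVg.
split.
- split=> [|g1 g2]; last by case: (psi_GG g1 g2).
  by rewrite /r psi_fix.
- exists (fun g => (phi (1, g)).2) => g; first by rewrite -vP psiK.
  have := phiK (1, g); case: (phi _) => h k.
  by rewrite psiE => -[].
- by move=> g1 g2; case: (psi_GG g1 g2).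
- by move=> g h; case: (psi_GH g h).
- by move=> g h; case: (psi_GH g h).
Qed.

(* The second conjunct says that the isomorphisms fixing H are exactly the maps
   (h, g) |-> (h * r g, v g) for the pairs (r, v) of the first conjunct. *)
Theorem corollary3p5 (H G : groupType) (beta : G -> H -> G)
    (ra : right_action_by_automorphisms beta)
    (alpha' : G -> H -> H) (beta' : G -> H -> G) :
  ((exists (mp : matched_pair alpha' beta') (psi : bicrossed mp -> rsemidirect ra),
      group_isomorphism psi /\ fixes_H psi)
   <-> (exists (r : G -> H) (v : G -> G), deforming_pair beta alpha' beta' r v))
  /\
  (forall (mp : matched_pair alpha' beta') (psi : bicrossed mp -> rsemidirect ra),
     (group_isomorphism psi /\ fixes_H psi)
     <-> (exists (r : G -> H) (v : G -> G),
            deforming_pair beta alpha' beta' r v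
            /\ forall (h : H) (g : G), psi (h, g) = (h * r g, v g))).
Proof.
split; last first.
  move=> mp psi; split=> [[iso fixH]|[r [v [rv psiE]]]].
    exact: isomorphism_deforming_pair.
  exact: deforming_pair_isomorphism rv psiE.
split=> [[mp [psi [iso fixH]]]|[r [v rv]]].
  have [r [v [rv _]]] := isomorphism_deforming_pair _ _ _ _ _ _ _ _ iso fixH.
  by exists r, v.
exists (deforming_pair_matched _ _ _ _ _ _ _ ra rv).
exists (fun x => (x.1 * r x.2, v x.2)).
exact: deforming_pair_isomorphism rv _.
Qed.
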